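(* Let $G$ be a finite graph without boundary and let $S\subseteq V(G)$ be such that $G_{S\to\partial}$ is layerable. Then for any $\mathbb{R}^\times$-network $(G,L)$, every eigenvalue of the generalized Laplacian $L$ has multiplicity at most $|S|$. In particular, this holds when $L$ is the standard adjacency matrix or the standard Laplacian of $G$.
   Context: Graphs are undirected multigraphs with vertex set $V$ and set $E$ of oriented edges (each undirected edge gives $e$ and its reverse $\overline{e}$); $e_+$, $e_-$ are the starting and ending vertices of $e$; $\mathcal{E}(x)=\{e: e_+=x\}$. A $\partial$-graph is a graph with a partition $V=V^\circ\sqcup\partial V$ (interior and boundary vertices); a graph without boundary is one with $\partial V=\varnothing$. $G_{S\to\partial}$ is the $\partial$-graph with the vertices and edges of $G$ and $\partial V=S$. An $\mathbb{R}^\times$-network $(G,L)$ is a $\partial$-graph with a generalized Laplacian $L:\mathbb{R}V\to\mathbb{R}V$, $Lx=d(x)x+\sum_{e\in\mathcal{E}(x)}w(e)(x-e_-)$, where $w:E\to\mathbb{R}\setminus\{0\}$ satisfies $w(\overline{e})=w(e)$ and $d:V\to\mathbb{R}$ is arbitrary. The standard Laplacian is the case $w=1,d=0$. Simple layerable extensions: $G'$ is obtained from $G$ by (i) adjoining an isolated boundary vertex $x$ if $V(G')=V(G)\sqcup\{x\}$, $E(G')=E(G)$, $V^\circ(G')=V^\circ(G)$, and $x$ is a boundary vertex of $G'$ with no incident edges; (ii) adjoining a boundary spike $e$ if $V(G')=V(G)\sqcup\{e_+\}$, $E(G')=E(G)\sqcup\{e,\overline{e}\}$, $V^\circ(G')=V^\circ(G)\sqcup\{e_-\}$,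 where in $G'$ the vertex $e_-$ is interior and $e_+$ is a boundary vertex with no other incident edges (so $e_-\in\partial V(G)$); (iii) adjoining a boundary edge $e$ if $V(G')=V(G)$, $V^\circ(G')=V^\circ(G)$, $E(G')=E(G)\sqcup\{e,\overline{e}\}$ and both endpoints of $e$ are boundary vertices. A finite $\partial$-graph is layerable if it is obtained from $\varnothing$ by finitely many such operations. *)

(* Defs.v *)
From HB Require Import structures.
From mathcomp Require Import all_boot all_order all_algebra.
From mathcomp Require Import reals.

Set Implicit Arguments.
Unset Strict Implicit.
Unset Printing Implicit Defensive.

Import Order.TTheory GRing.Theory Num.Theory.
Local Open Scope ring_scope.

(* An undirected edge, loop or not, is a pair of distinct oriented edges
   exchanged by [rev]. *)
Record dgraph := DGraph {
  vertex : finType;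
  edge : finType;
  start : edge -> vertex;                     (* e_+ *)
  rev : edge -> edge;
  revK : involutive rev;
  rev_neq : forall e, rev e != e;
  bd : {set vertex}
}.

Arguments start {d}.
Arguments rev {d}.
Arguments bd d : clear implicits.

Definition target (G : dgraph) (e : edge G) : vertex G := start (rev e). (* e_- *)

Definition interior (G : dgraph) : {set vertex G} := ~: bd G.

Definition edges_at (G : dgraph) (x : vertex G) : {set edge G} :=
  [set e | start e == x].

Definition without_boundary (G : dgraph) : Prop := bd G = set0.

(* G_{S -> bd} *)
Definition with_boundary (G : dgraph) (S : {set vertex G}) : dgraph :=
  DGraph (@start G) (@revK G) (@rev_neq G) S.

(* The inclusion of G in G' is an injective morphism of the underlying
   multigraphs rather than a literal inclusion; it does not constrain the
   boundaries, which each kind of extension prescribes. *)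
Record embedding (G G' : dgraph) := Embedding {
  emb_v : vertex G -> vertex G';
  emb_e : edge G -> edge G';
  emb_v_inj : injective emb_v;
  emb_e_inj : injective emb_e;
  emb_start : forall e, start (emb_e e) = emb_v (start e);
  emb_rev : forall e, rev (emb_e e) = emb_e (rev e)
}.

Section Images.
Variables (G G' : dgraph) (f : embedding G G').
Definition vertices_of : {set vertex G'} := emb_v f @: [set: vertex G].
Definition edges_of : {set edge G'} := emb_e f @: [set: edge G].
Definition interior_of : {set vertex G'} := emb_v f @: interior G.
End Images.

(* A = B |_| C *)
Definition disjoint_union (T : finType) (A B C : {set T}) : Prop :=
  A = B :|: C /\ [disjoint B & C].

Definition adjoins_isolated_boundary_vertex (G G' : dgraph) : Prop :=
  exists (f : embedding G G') (x : vertex G'),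
    [/\ disjoint_union [set: vertex G'] (vertices_of f) [set x],
        [set: edge G'] = edges_of f,
        interior G' = interior_of f,
        x \in bd G'
      & edges_at x = set0].

Definition adjoins_boundary_spike (G G' : dgraph) : Prop :=
  exists (f : embedding G G') (e : edge G'),
    [/\ disjoint_union [set: vertex G'] (vertices_of f) [set start e],
        disjoint_union [set: edge G'] (edges_of f) [set e; rev e],
        disjoint_union (interior G') (interior_of f) [set target e],
        start e \in bd G'
      & edges_at (start e) = [set e]].

Definition adjoins_boundary_edge (G G' : dgraph) : Prop :=
  exists (f : embedding G G') (e : edge G'),
    [/\ [set: vertex G'] = vertices_of f,
        interior G' = interior_of f,
        disjoint_union [set: edge G'] (edges_of f) [set e; rev e],
        start e \in bd G'
      & target e \in bd G'].

Definition simple_layerable_extension (G G' : dgraph) : Prop :=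
  [\/ adjoins_isolated_boundary_vertex G G',
      adjoins_boundary_spike G G'
    | adjoins_boundary_edge G G'].

Inductive layerable : dgraph -> Prop :=
| layerable_empty G : #|vertex G| = 0%N -> layerable G
| layerable_extension G G' :
    layerable G -> simple_layerable_extension G G' -> layerable G'.

Record network (R : realType) (G : dgraph) := Network {
  weight : edge G -> R;
  potential : vertex G -> R;
  weight_neq0 : forall e, weight e != 0;
  weight_rev : forall e, weight (rev e) = weight e
}.

(* The basis element x of RV, RV being the space of row vectors 'rV[R]_#|V|. *)
Definition basis_vertex (R : realType) (G : dgraph) (x : vertex G) :
    'rV[R]_#|vertex G| := delta_mx 0 (enum_rank x).

(* L x = d(x) x + \sum_(e in E(x)) w(e) (x - e_-) *)
Definition laplacian_image (R : realType) (G : dgraph) (N : network R G)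
    (x : vertex G) : 'rV[R]_#|vertex G| :=
  potential N x *: basis_vertex R x
  + \sum_(e in edges_at x)
      weight N e *: (basis_vertex R x - basis_vertex R (target e)).

(* L as a matrix acting on row vectors from the right, as in [eigenspace]: the
   row of index x is the image of x. *)
Definition laplacian (R : realType) (G : dgraph) (N : network R G) :
    'M[R]_#|vertex G| :=
  \matrix_i laplacian_image N (enum_val i).

Definition standard_network (R : realType) (G : dgraph) : network R G :=
  @Network R G (fun _ => 1) (fun _ => 0)
    (fun _ => oner_neq0 R) (fun _ => erefl).

Definition standard_laplacian (R : realType) (G : dgraph) :
    'M[R]_#|vertex G| := laplacian (standard_network R G).

(* Oriented edges are counted, so a loop contributes 2 to its diagonal entry. *)
Definition adjacency_matrix (R : realType) (G : dgraph) :
    'M[R]_#|vertex G| :=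
  \matrix_(i, j)
    #|[set e : edge G | (start e == enum_val i) && (target e == enum_val j)]|%:R.

(* All matrices considered here are symmetric, so that the geometric and the
   algebraic multiplicities coincide; both are bounded. *)
Definition eigenvalue_multiplicities_le (R : realType) (n : nat) (A : 'M[R]_n)
    (k : nat) : Prop :=
  forall a : R, eigenvalue A a ->
    (\rank (eigenspace A a) <= k)%N /\ (mup a (char_poly A) <= k)%N.

(* Main.v *)
Require Import Defs.
From mathcomp Require Import all_boot all_order all_algebra.
From mathcomp Require Import reals.

(** Fix an eigenvalue [a] of [L].  Subtracting [a] from the potential turns the
    eigenvectors of [L] into harmonic functions: [L] is symmetric, so [v] is in
    the eigenspace if and only if, at every vertex [x],

      [(d x - a) * v x + \sum_(e in edges_at x) w e * (v x - v (target e)) = 0].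

    On a layerable graph a function that is harmonic at every vertex, those of
    the boundary included, and that vanishes on the boundary is zero
    ([layerable_harmonic_eq0]).  Undo one extension at a time: an isolated
    vertex carries the value zero, a boundary edge carries no current since both
    its ends have value zero, and at the tip of a boundary spike harmonicity
    says that the other end has the same value as the tip, namely zero.  Hence
    restriction to [S] is injective on the eigenspace, whose dimension is at most
    [#|S|].

    The algebraic multiplicity is no larger.  For a symmetric matrix [A] over an
    ordered field the kernel and the image of [A - a] are orthogonal, hence meet
    trivially, and the space is their direct sum; both summands are stable under
    [A], so that the characteristic polynomial of [A] is [('X - a) ^+ r], for [r]
    the dimension of the kernel, times that of the restriction of [A] to the
    image, of which [a] is not a root ([mup_char_poly_eigenspace]).

    The adjacency matrix is the generalized Laplacian with all weights [-1] whose
    potential is the degree. *)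

Set Implicit Arguments.
Unset Strict Implicit.
Unset Printing Implicit Defensive.

Import Order.TTheory GRing.Theory Num.Theory.
Local Open Scope ring_scope.

(** * Multiplicities of an eigenvalue of a matrix *)

Section Multiplicity.
Variable F : fieldType.

Lemma char_poly_scalar k (a : F) :
  char_poly (a%:M : 'M_k) = ('X - a%:P) ^+ k.
Proof. by rewrite /char_poly /char_poly_mx map_scalar_mx -raddfB det_scalar. Qed.

Lemma char_poly_block_diag k m (A : 'M[F]_k) (D : 'M_m) :
  char_poly (block_mx A 0 0 D) = char_poly A * char_poly D.
Proof.
rewrite /char_poly /char_poly_mx map_block_mx !map_mx0 scalar_mx_block.
by rewrite opp_block_mx add_block_mx !oppr0 !addr0 det_ublock.
Qed.

Lemma char_poly_conj n (P A B : 'M[F]_n) :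
  P \in unitmx -> P *m A = B *m P -> char_poly A = char_poly B.
Proof.
move=> uP PA; have detP : \det (map_mx polyC P) != 0.
  by rewrite det_map_mx polyC_eq0 -unitfE -unitmxE.
apply: (mulfI detP); rewrite mulrC [RHS]mulrC.
rewrite [LHS]mulrC -!det_mulmx /char_poly_mx mulmxBr mulmxBl -!map_mxM PA.
by rewrite scalar_mxC.
Qed.

(** The matrix of [A] in a basis adapted to two complementary stable subspaces,
    the first of which consists of eigenvectors, is block diagonal. *)
Lemma mup_char_poly_adapted n k m (A : 'M[F]_n) a (K : 'M_(k, n))
    (W : 'M_(m, n)) (D : 'M_m) :
    n = (k + m)%N -> row_free (col_mx K W) ->
    K *m A = a *: K -> W *m A = D *m W -> ~~ eigenvalue D a ->
  mup a (char_poly A) = k.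
Proof.
move=> n_km; case: _ / (esym n_km) in A K W *.
rewrite row_free_unit => uP KA WA aD.
rewrite (@char_poly_conj _ (col_mx K W) A (block_mx a%:M 0 0 D)) //; last first.
  by rewrite mul_col_mx mul_block_col !mul0mx addr0 add0r mul_scalar_mx KA WA.
rewrite char_poly_block_diag char_poly_scalar mupMl -?eigenvalue_root_char //.
by rewrite mup_XsubCX eqxx.
Qed.

(** The hypothesis says that the eigenspace is the whole characteristic
    subspace. *)
Lemma mup_char_poly_eigenspace n (A : 'M[F]_n) a :
  (eigenspace A a :&: (A - a%:M) = 0)%MS ->
  mup a (char_poly A) = \rank (eigenspace A a).
Proof.
set B := A - a%:M => capKB.
pose K := row_base (eigenspace A a); pose W := row_base B.
have eig_B0 p (v : 'M_(p, n)) :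
    (v <= eigenspace A a)%MS -> (v <= B)%MS -> v = 0.
  by move=> vK vB; apply/eqP; rewrite -submx0 -capKB sub_capmx vK.
(* the image of [B] is stable under [A = B + a%:M] *)
have [D WA] : exists D, W *m A = D *m W.
  apply/submxP; rewrite eq_row_base.
  have AE : A = B + a%:M by rewrite subrK.
  rewrite AE mulmxDr mul_mx_scalar addmx_sub ?submxMl //.
  by rewrite scalemx_sub // eq_row_base.
apply: (@mup_char_poly_adapted _ _ _ A a K W D) => //.
- by rewrite mxrank_ker subnK // rank_leq_row.
- apply: inj_row_free => v; rewrite -[v]hsubmxK mul_row_col.
  set x := lsubmx v; set y := rsubmx v => xy0.
  have xK0 : x *m K = 0.
    apply: eig_B0; first by rewrite (submx_trans (submxMl _ _)) ?eq_row_base.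
    rewrite -[x *m K]opprK (addr0_eq xy0) -mulNmx (submx_trans (submxMl _ _)) //.
    by rewrite eq_row_base.
  have yW0 : y *m W = 0 by rewrite xK0 add0r in xy0.
  have -> : x = 0 by apply: (row_free_inj (row_base_free _)); rewrite mul0mx.
  have -> : y = 0 by apply: (row_free_inj (row_base_free _)); rewrite mul0mx.
  by rewrite row_mx0.
- by apply/eigenspaceP; rewrite eq_row_base.
apply/eigenvalueP => -[y yD]; apply/negP/negPn/eqP.
apply: (row_free_inj (row_base_free B)); rewrite mul0mx; apply: eig_B0.
  by apply/eigenspaceP; rewrite -mulmxA WA mulmxA yD scalemxAl.
by rewrite (submx_trans (submxMl _ _)) ?eq_row_base.
Qed.

(** A subspace on which the coordinates indexed by [S] separate the vectors has
    dimension at most [#|S|]. *)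
Lemma rank_le_card_coord n p (E : 'M[F]_(p, n)) (T : finType) (S : {set T})
    (r : T -> 'I_n) :
    (forall v : 'rV_n, (v <= E)%MS -> (forall x, x \in S -> v 0 (r x) = 0) ->
       v = 0) ->
  (\rank E <= #|S|)%N.
Proof.
move=> sepE.
pose K := row_base E; pose M := colsub (fun j : 'I_#|S| => r (enum_val j)) K.
suff /eqP <- : row_free M by rewrite rank_leq_col.
apply: inj_row_free => v vM0.
apply: (row_free_inj (row_base_free E)); rewrite mul0mx.
apply: sepE => [|x xS].
  by rewrite (submx_trans (submxMl _ _)) ?eq_row_base.
have /matrixP/(_ 0 (enum_rank_in xS x)) := vM0; rewrite !mxE; apply: etrans.
by apply: eq_bigr => i _; rewrite [in RHS]mxE enum_rankK_in.
Qed.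

End Multiplicity.

Lemma row_dot_eq0 (F : realDomainType) n (v : 'rV[F]_n) :
  v *m v^T = 0 -> v = 0.
Proof.
move=> /matrixP/(_ 0 0); rewrite !mxE => /eqP.
rewrite psumr_eq0 => [/allP v0|i _]; last by rewrite mxE -expr2 sqr_ge0.
apply/rowP => i; have := v0 i (mem_index_enum _).
by rewrite !mxE -expr2 sqrf_eq0 => /eqP.
Qed.

(** If [v = z *m B] with [v *m B = 0] and [B] symmetric, then
    [v *m v^T = z *m (v *m B)^T = 0]. *)
Lemma sym_eigenspace_cap (F : realFieldType) n (A : 'M[F]_n) a :
  A^T = A -> (eigenspace A a :&: (A - a%:M) = 0)%MS.
Proof.
move=> symA; apply/eqP; rewrite -submx0; apply/rV_subP => v.
rewrite sub_capmx => /andP[/sub_kermxP vB0 /submxP[z vE]].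
have symB : (A - a%:M)^T = A - a%:M by rewrite linearB /= symA tr_scalar_mx.
suff -> : v = 0 by rewrite sub0mx.
apply: row_dot_eq0.
by rewrite {1}vE -mulmxA -[A - _]symB -trmx_mul vB0 trmx0 mulmx0.
Qed.

(** * Harmonic functions on layerable graphs *)

Section Harmonic.
Variable F : idomainType.

(** The generalized Laplacian on functions; no symmetry of [w] is assumed. *)
Definition lap (G : dgraph) (w : edge G -> F) (d u : vertex G -> F)
    (x : vertex G) : F :=
  d x * u x + \sum_(e in edges_at x) w e * (u x - u (target e)).

Lemma target_rev (G : dgraph) (e : edge G) : target (Defs.rev e) = start e.
Proof. by rewrite /target Defs.revK. Qed.

Lemma emb_target (G G' : dgraph) (f : embedding G G') e :
  target (emb_e f e) = emb_v f (target e).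
Proof. by rewrite /target emb_rev emb_start. Qed.

(** The Laplacian may be computed in a subgraph when the edges outside it carry
    no current. *)
Lemma lap_embedding (G G' : dgraph) (f : embedding G G') w d u x :
    (forall e, e \notin edges_of f -> start e = emb_v f x ->
       u (start e) = u (target e)) ->
  lap w d u (emb_v f x) = lap (w \o emb_e f) (d \o emb_v f) (u \o emb_v f) x.
Proof.
move=> nocur; congr (_ + _).
rewrite (bigID (mem (edges_of f))) /= [X in _ + X]big1 ?addr0; last first.
  move=> e /andP[]; rewrite inE => /eqP se eN.
  by rewrite -se -nocur // subrr mulr0.
rewrite (eq_bigl (fun e => e \in emb_e f @: edges_at x)) => [|e].
  rewrite big_imset /=; last by move=> e1 e2 _ _; apply: emb_e_inj.
  by apply: eq_bigr => e _; rewrite emb_target.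
apply/andP/imsetP => [[+ /imsetP[e' _ eE]]|[e' + ->]]; last first.
  by rewrite !inE => /eqP se; rewrite emb_start se imset_f.
rewrite eE !inE emb_start (inj_eq (@emb_v_inj _ _ f)) => se.
by exists e'; rewrite ?inE.
Qed.

Lemma emb_interior_of (G G' : dgraph) (f : embedding G G') x :
  (emb_v f x \in interior_of f) = (x \notin bd G).
Proof. by rewrite mem_imset ?inE //; apply: emb_v_inj. Qed.

Lemma in_interior (G : dgraph) (x : vertex G) : (x \in interior G) = (x \notin bd G).
Proof. by rewrite inE. Qed.

(** By induction on the construction of the graph: harmonicity and vanishing on
    the boundary descend from [G'] to [G]. *)
Lemma layerable_harmonic_eq0 (G : dgraph) (w : edge G -> F)
    (d u : vertex G -> F) :
    layerable G -> (forall e, w e != 0) -> (forall x, lap w d u x = 0) ->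
    (forall x, x \in bd G -> u x = 0) ->
  forall x, u x = 0.
Proof.
move=> layG; elim: layG w d u => {G}[G G0|G G' _ IH].
  by move=> w d u _ _ _ x; have := fintype0 x G0.
have vertex_image (f : embedding G G') (y : vertex G') :
  y \in vertices_of f -> exists x, y = emb_v f x.
  by case/imsetP => x _ ->; exists x.
case=> [[f [x0 [[VE _] EE intE x0bd _]]]
       |[f [e [[VE _] [EE _] [intE _] tip star]]]
       |[f [e [VE intE [EE _] sbd tbd]]]] w d u w0 Lu ubd.
- have uf x : u (emb_v f x) = 0.
    move: x; apply: (IH (w \o emb_e f) (d \o emb_v f)) => [e|x|x xbd] /=.
    + exact: w0.
    + by rewrite -lap_embedding // => e; rewrite -EE inE.
    + by apply: ubd; rewrite -[_ \in _]negbK -in_interior intE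
        emb_interior_of negbK.
  move=> y; have: y \in [set: vertex G'] by [].
  rewrite VE in_setU => /orP[/vertex_image[x ->] //|].
  by rewrite inE => /eqP->; apply: ubd.
- have us : u (start e) = 0 by apply: ubd.
  (* harmonicity at the tip reads [w e * (0 - u (target e)) = 0] *)
  have ut : u (target e) = 0.
    have := Lu (start e); rewrite /lap star big_set1 us mulr0 add0r sub0r.
    by move/eqP; rewrite mulf_eq0 (negPf (w0 e)) oppr_eq0 => /eqP.
  (* the boundary of [G] is that of [G'] without the tip, plus the other end *)
  have uf x : u (emb_v f x) = 0.
    move: x; apply: (IH (w \o emb_e f) (d \o emb_v f)) => [e'|x|x xbd] /=.
    + exact: w0.
    + rewrite -lap_embedding // => e' e'N _.
      have: e' \in [set: edge G'] by [].
      rewrite EE !inE (negPf e'N) /= => /orP[]/eqP->; first by rewrite us ut.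
      by rewrite target_rev us; exact: ut.
    + have [->//|neq] := eqVneq (emb_v f x) (target e).
      apply: ubd; rewrite -[_ \in _]negbK -in_interior intE in_setU.
      by rewrite emb_interior_of xbd inE.
  move=> y; have: y \in [set: vertex G'] by [].
  rewrite VE in_setU => /orP[/vertex_image[x ->] //|].
  by rewrite inE => /eqP->.
have us : u (start e) = 0 by apply: ubd.
have ut : u (target e) = 0 by apply: ubd.
move=> y; have: y \in [set: vertex G'] by [].
rewrite VE => /vertex_image[x ->] {y}; move: x.
apply: (IH (w \o emb_e f) (d \o emb_v f)) => [e'|x|x xbd] /=.
- exact: w0.
- rewrite -lap_embedding // => e' e'N _.
  have: e' \in [set: edge G'] by [].
  rewrite EE !inE (negPf e'N) /= => /orP[]/eqP->; first by rewrite us ut.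
  by rewrite target_rev us; exact: ut.
- by apply: ubd; rewrite -[_ \in _]negbK -in_interior intE
    emb_interior_of negbK.
Qed.

End Harmonic.

(** * Generalized Laplacians *)

Section Laplacian.
Variables (R : realType) (G : dgraph).
Implicit Types (N : network R G) (x y : vertex G).

Lemma basis_vertexE x y :
  basis_vertex R x 0 (enum_rank y) = (y == x)%:R.
Proof. by rewrite mxE (inj_eq enum_rank_inj). Qed.

Lemma laplacianE N x y :
  laplacian N (enum_rank x) (enum_rank y) =
  potential N x * (y == x)%:R
  + \sum_(e in edges_at x) weight N e * ((y == x)%:R - (y == target e)%:R).
Proof.
rewrite /laplacian mxE enum_rankK /laplacian_image mxE summxE.
rewrite [fun_of_matrix (_ *: _) _ _]mxE basis_vertexE; congr (_ + _).
apply: eq_bigr => e _; rewrite mxE [fun_of_matrix (_ - _) _ _]mxE.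
by rewrite [fun_of_matrix (- _) _ _]mxE !basis_vertexE.
Qed.

Lemma laplacian_sym N : (laplacian N)^T = laplacian N.
Proof.
apply/matrixP => i j; rewrite mxE -(enum_valK i) -(enum_valK j).
move: (enum_val i) (enum_val j) => x y {i j}; rewrite !laplacianE.
have [->//|neq] := eqVneq x y.
rewrite !mulr0 !add0r.
(* off the diagonal, reversal exchanges the edges from [x] to [y] with those
   from [y] to [x] *)
under eq_bigr do rewrite sub0r mulrN.
under [RHS]eq_bigr do rewrite sub0r mulrN.
rewrite !sumrN; congr (- _).
rewrite big_mkcond [RHS]big_mkcond /= (reindex_inj (can_inj (@Defs.revK G))) /=.
apply: eq_bigr => e _; rewrite !inE target_rev weight_rev.
rewrite ![_ == start _]eq_sym.
by do 2 case: eqP; rewrite ?mulr1 ?mulr0.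
Qed.

(** The transpose of [v] is used because [laplacian] acts on rows. *)
Lemma laplacian_mul N (v : 'rV[R]_#|vertex G|) x :
  (laplacian N *m v^T) (enum_rank x) 0 =
  lap (weight N) (potential N) (fun y => v 0 (enum_rank y)) x.
Proof.
have basisM y : (basis_vertex R y *m v^T) 0 0 = v 0 (enum_rank y).
  by rewrite -rowE !mxE.
have -> : (laplacian N *m v^T) (enum_rank x) 0 =
    (laplacian_image N x *m v^T) 0 0.
  have <- : row (enum_rank x) (laplacian N) = laplacian_image N x.
    by rewrite rowK enum_rankK.
  by rewrite -row_mul [RHS]mxE.
rewrite /laplacian_image mulmxDl mxE -scalemxAl mxE basisM; congr (_ + _).
rewrite mulmx_suml summxE; apply: eq_bigr => e _.
by rewrite -scalemxAl mxE mulmxBl [fun_of_matrix (_ - _) _ _]mxE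
  [fun_of_matrix (- _) _ _]mxE !basisM.
Qed.

Lemma laplacian_eigenvector_lap N a (v : 'rV[R]_#|vertex G|) x :
    (v <= eigenspace (laplacian N) a)%MS ->
  lap (weight N) (fun y => potential N y - a) (fun y => v 0 (enum_rank y)) x
  = 0.
Proof.
move=> /eigenspaceP vL.
have := laplacian_mul N v x.
rewrite -[laplacian N]laplacian_sym -trmx_mul vL !mxE /lap mulrBl => ->.
by rewrite addrAC subrr.
Qed.

Lemma layerable_multiplicities (S : {set vertex G}) N :
  layerable (with_boundary S) ->
  eigenvalue_multiplicities_le (laplacian N) #|S|.
Proof.
move=> layS a _.
rewrite mup_char_poly_eigenspace; last exact/sym_eigenspace_cap/laplacian_sym.
suff rS : (\rank (eigenspace (laplacian N) a) <= #|S|)%N by [].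
apply: (@rank_le_card_coord _ _ _ _ _ S enum_rank) => v vL vS0.
apply/rowP => i; rewrite -(enum_valK i) [RHS]mxE.
apply: (@layerable_harmonic_eq0 _ (with_boundary S) (weight N)
          (fun y => potential N y - a) (fun y => v 0 (enum_rank y)) layS) => //.
  by move=> e; apply: (weight_neq0 N e).
by move=> x; apply: (laplacian_eigenvector_lap x vL).
Qed.

(** The potential, the degree with loops counted twice, cancels the diagonal
    terms coming from the edges. *)
Definition adjacency_network : network R G :=
  @Network R G (fun _ => -1) (fun x => #|edges_at x|%:R)
    (fun _ => lreg_neq0 (lregN (@lreg1 R))) (fun _ => erefl).

Lemma adjacency_matrixE : adjacency_matrix R G = laplacian adjacency_network.
Proof.
apply/matrixP => i j; rewrite -(enum_valK i) -(enum_valK j) laplacianE /=.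
move: (enum_val i) (enum_val j) => x y {i j}.
rewrite mxE !enum_rankK.
under eq_bigr do rewrite mulN1r opprB.
rewrite sumrB sumr_const mulr_natl addrCA subrr addr0.
rewrite -sum1_card natr_sum big_mkcond [RHS]big_mkcond /=.
apply: eq_bigr => e _; rewrite !inE [y == _]eq_sym.
by case: eqP => //= _; case: eqP.
Qed.

End Laplacian.

Theorem corollary5p29 (R : realType) (G : dgraph) (S : {set vertex G}) :
  without_boundary G ->
  layerable (with_boundary S) ->
  [/\ forall N : network R G,
        eigenvalue_multiplicities_le (laplacian N) #|S|,
      eigenvalue_multiplicities_le (adjacency_matrix R G) #|S|
    & eigenvalue_multiplicities_le (standard_laplacian R G) #|S|].
Proof.
move=> _ layS; rewrite adjacency_matrixE.
by split=> [N||]; apply: layerable_multiplicities.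
Qed.
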